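(* There is a fixed constant $\epsilon>0$ and an absolute constant $c>0$, together with a polynomial-time reduction that maps each instance $(G,k)$ of Vertex Cover, where $G=(V,E)$ is a triangle-free graph with $m=|E|$ edges and $k$ is a positive integer, to an instance of Euclidean $k$-means (a finite point set in Euclidean space, to be clustered with $k$ centers), such that: (i) if $G$ has a vertex cover of size $k$, then the $k$-means instance has a solution of cost at most $m-k$; (ii) if every vertex cover of $G$ has size at least $k(1+\epsilon)$, then the optimal $k$-means cost of the instance is at least $m-(1-c\epsilon)k$.
   Context: A vertex cover of a graph $G=(V,E)$ is a set $S\subseteq V$ such that every edge has at least one endpoint in $S$. A graph is triangle-free if it contains no cycle of length 3. Euclidean $k$-means: given a finite set $P\subset\mathbb{R}^d$ and integer $k$, choose centers $c_1,\dots,c_k\in\mathbb{R}^d$ minimizing $\sum_{x\in P}\min_i\|x-c_i\|^2$.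
   Formalization: In (i) the cost bound m−k is replaced by max(0, m−k), since for k>m (e.g. a single edge with k=2) a cost of at most m−k<0 is impossible; for k≤m the bound is unchanged. *)

(* Defs.v *)
From HB Require Import structures.
From Corelib Require Import BinNums.
From mathcomp Require Import all_boot all_order all_algebra.
From mathcomp Require Import all_classical all_reals.

Set Implicit Arguments.
Unset Strict Implicit.
Unset Printing Implicit Defensive.

Import Order.TTheory GRing.Theory Num.Theory.
Local Open Scope ring_scope.

Record sgraph := SGraph {
  gorder : nat;
  adj : rel 'I_gorder;
  adj_sym : symmetric adj;
  adj_irr : irreflexive adj }.

Definition edges (G : sgraph) : {set {set 'I_(gorder G)}} :=
  [set A | [exists u, exists v, adj u v && (A == [set u; v])]].

(* u, v, w are automatically distinct, since adj is irreflexive. *)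
Definition triangle_free (G : sgraph) : Prop :=
  forall u v w : 'I_(gorder G), ~ [/\ adj u v, adj v w & adj w u].

Definition vertex_cover (G : sgraph) (S : {set 'I_(gorder G)}) : Prop :=
  forall u v, adj u v -> u \in S \/ v \in S.

Record vc_instance := VCInstance {
  vc_graph : sgraph;
  vc_k : nat;
  vc_triangle_free : triangle_free vc_graph;
  vc_k_gt0 : (0 < vc_k)%N }.

(* A duplicate-free list represents the finite point set; coordinates are
   rational so that an instance can be the output of an algorithm. The centers
   of a solution range over the real space. *)
Record kmeans_instance := KMeansInstance {
  km_dim : nat;
  km_points : seq 'rV[rat]_km_dim;
  km_points_uniq : uniq km_points;
  km_k : nat;
  km_k_gt0 : (0 < km_k)%N }.

Definition sqdist (R : realType) (d : nat) (x y : 'rV[R]_d) : R :=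
  \sum_(j < d) (x 0 j - y 0 j) ^+ 2.

Definition centers (R : realType) (J : kmeans_instance) :=
  'I_(km_k J) -> 'rV[R]_(km_dim J).

(* The seed of the iterated minimum is the term of the first center. *)
Definition min_sqdist (R : realType) (J : kmeans_instance) (C : centers R J)
    (x : 'rV[R]_(km_dim J)) : R :=
  \big[Num.min/sqdist x (C (Ordinal (km_k_gt0 J)))]_(i < km_k J)
     sqdist x (C i).

Definition kmeans_cost (R : realType) (J : kmeans_instance) (C : centers R J) : R :=
  \sum_(x <- km_points J) min_sqdist C (map_mx ratr x).

Definition kmeans_opt (R : realType) (J : kmeans_instance) : R :=
  inf (range (@kmeans_cost R J)).

Variant symbol := Bit of bool | Sep.

(* [None] is the blank. *)
Definition cell := option symbol.

Variant move := MoveL | MoveN | MoveR.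

(* A two-way infinite tape: [tleft] lists the cells to the left of the head,
   nearest first, and [tright] the scanned cell and those to its right; all
   cells beyond the two lists are blank. *)
Record tape := Tape { tleft : seq cell; tright : seq cell }.

Definition tread (t : tape) : cell := head None (tright t).

Definition twrite (a : cell) (t : tape) : tape :=
  Tape (tleft t) (a :: behead (tright t)).

Definition tmove (mv : move) (t : tape) : tape :=
  match mv with
  | MoveL => Tape (behead (tleft t)) (head None (tleft t) :: tright t)
  | MoveN => t
  | MoveR => Tape (tread t :: tleft t) (behead (tright t))
  end.

Record TM := MkTM {
  tm_state : finType;
  tm_tape : finType;
  tm_start : tm_state;
  tm_halt : pred tm_state;
  tm_in : tm_tape;
  tm_out : tm_tape;
  tm_delta : tm_state -> (tm_tape -> cell) ->
             tm_state * (tm_tape -> cell * move) }.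

Record config (M : TM) := Config {
  cstate : tm_state M;
  ctape : tm_tape M -> tape }.

Definition init_config (M : TM) (w : seq symbol) : config M :=
  Config (tm_start M)
    (fun i => if i == tm_in M then Tape [::] (map Some w) else Tape [::] [::]).

Definition tm_step (M : TM) (c : config M) : config M :=
  if tm_halt (cstate c) then c else
  let: (q, act) := tm_delta (cstate c) (fun i => tread (ctape c i)) in
  Config q (fun i => tmove (act i).2 (twrite (act i).1 (ctape c i))).

Definition tape_holds (t : tape) (w : seq symbol) : Prop :=
  exists a b : nat,
    rev (tleft t) ++ tright t = nseq a None ++ map Some w ++ nseq b None.

Definition computes_within (M : TM) (w v : seq symbol) (t : nat) : Prop :=
  let c := iter t (@tm_step M) (init_config M w) in
  tm_halt (cstate c) /\ tape_holds (ctape c (tm_out M)) v.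

Definition polytime_computable (A B : Type)
    (encA : A -> seq symbol) (encB : B -> seq symbol) (f : A -> B) : Prop :=
  exists (M : TM) (a e : nat), forall x : A,
    computes_within M (encA x) (encB (f x)) (a * size (encA x) ^ e + a)%N.

(* Binary digits, least significant first; zero has no digits. *)
Fixpoint bits_pos (p : positive) : seq bool :=
  match p with
  | xH => [:: true]
  | xO q => false :: bits_pos q
  | xI q => true :: bits_pos q
  end.

Definition encode_nat (n : nat) : seq symbol :=
  map Bit (if bin_of_nat n is Npos p then bits_pos p else [::]).

Definition encode_rat (q : rat) : seq symbol :=
  Bit (numq q < 0) :: encode_nat `|numq q|%N ++ Sep ::
  rcons (encode_nat `|denq q|%N) Sep.

Definition encode_point (d : nat) (x : 'rV[rat]_d) : seq symbol :=
  rcons (flatten [seq encode_rat (x 0 j) | j <- enum 'I_d]) Sep.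

(* k in binary, the dimension in unary, then the points. *)
Definition encode_kmeans (J : kmeans_instance) : seq symbol :=
  encode_nat (km_k J) ++ Sep ::
  nseq (km_dim J) (Bit true) ++ Sep ::
  flatten [seq encode_point x | x <- km_points J].

(* k in binary, then the rows of the adjacency matrix. *)
Definition encode_vc (I : vc_instance) : seq symbol :=
  encode_nat (vc_k I) ++ Sep ::
  flatten [seq rcons [seq Bit (adj u v) | v <- enum 'I_(gorder (vc_graph I))] Sep
          | u <- enum 'I_(gorder (vc_graph I))].

(* Main.v *)
(* An edge A, a 2-subset of the vertices, becomes its indicator vector, so two
   distinct edges are at squared distance 2 if they meet and 4 if they are
   disjoint.  Since |F| times the optimal cost of a cluster F is half the sum of
   the squared distances over ordered pairs, a star costs |F| - 1, and in general
   the cost is |F| - 1 plus the average over e in F of the number d(e) of edges of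
   F disjoint from e.  In a triangle-free F this average controls the vertex cover
   number: the edge e minimising d gives a cover of size 2 + d(e), and if d(e) = 0
   then either F is a star or every other edge has positive d.  Hence F has a cover
   of size at most 1 + 2 (cost - |F| + 1), and summing over the k clusters gives the
   soundness bound with c = 1/2.

   The Turing machine scans row u of the adjacency matrix with a work tape of
   length n in lockstep; the work tape carries a mark at position u, and a second
   mark at v turns it into the coordinate list of the edge uv. *)
From HB Require Import structures.
Require Import Defs.
From mathcomp Require Import all_boot all_order all_algebra.
From mathcomp Require Import all_classical all_reals.
From mathcomp Require Import zify ring lra.

Set Implicit Arguments.
Unset Strict Implicit.
Unset Printing Implicit Defensive.

Import Order.TTheory GRing.Theory Num.Theory.
Local Open Scope ring_scope.

(** * Clusters of edges *)

Section DisjointPairs.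

Local Open Scope nat_scope.

Variable T : finType.
Implicit Types (A B S : {set T}) (F : {set {set T}}).

Definition covers S F := forall A, A \in F -> exists2 x, x \in A & x \in S.

Definition disjoint_degree F A := #|[set B in F | [disjoint A & B]]|.

Lemma covers_disjoint_degree F A :
    (forall B, B \in F -> B != finset.set0) -> A \in F ->
  exists2 S, covers S F & (#|S| <= #|A| + disjoint_degree F A).
Proof.
move=> F0 FA; have /set0Pn[a _] := F0 _ FA.
pose h B := odflt a [pick x in B].
exists (A :|: h @: [set B in F | [disjoint A & B]]); last first.
  apply: leq_trans (leq_card_setU _ _) _.
  by rewrite leq_add2l leq_imset_card.
move=> B FB; case: (boolP [disjoint A & B]) => dAB.
  exists (h B).
    rewrite /h; case: pickP => [//|noB].
    by have /set0Pn[x] := F0 _ FB; rewrite noB.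
  by rewrite inE imset_f ?orbT // inE FB.
have /pred0Pn[x /= /andP[xA xB]] := dAB.
by exists x; rewrite // inE xA.
Qed.

Lemma card2_eq_set2 A x y : #|A| = 2 -> x \in A -> y \in A -> x != y ->
  A = [set x; y].
Proof.
move=> A2 xA yA xy; apply/esym/eqP; rewrite eqEcard A2 cards2 xy leqnn andbT.
by apply/fintype.subsetP => z; rewrite !inE => /orP[] /eqP ->.
Qed.

Lemma card2_has_other A x : #|A| = 2 -> x \in A ->
  exists2 y, x != y & A = [set x; y].
Proof.
move=> A2 xA; have : (0 < #|A :\ x|) by have := cardsD1 x A; rewrite xA; lia.
case/card_gt0P=> y; rewrite !inE => /andP[yx yA].
by exists y; [rewrite eq_sym | apply: card2_eq_set2; rewrite // eq_sym].
Qed.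

Variable F : {set {set T}}.
Hypothesis F2 : forall A, A \in F -> #|A| = 2.
Hypothesis F_triangle_free : forall x y z,
  [set x; y] \in F -> [set x; z] \in F -> [set y; z] \in F -> False.

Let F0 A : A \in F -> A != finset.set0.
Proof. by move=> FA; rewrite -card_gt0 (F2 FA). Qed.

Let disjointN A B : A \in F -> B \in F -> disjoint_degree F A = 0 ->
  exists2 x, x \in A & x \in B.
Proof.
move=> FA FB /eqP; rewrite cards_eq0 => /eqP/setP/(_ B).
rewrite !inE FB /= => /negbT/pred0Pn[x /= /andP[xA xB]].
by exists x.
Qed.

Lemma two_universal_edges A B :
    A \in F -> B \in F -> A != B ->
    disjoint_degree F A = 0 -> disjoint_degree F B = 0 ->
  exists x, covers [set x] F.
Proof.
move=> FA FB AB dA dB; have [x xA xB] := disjointN FA FB dA.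
have [y xy eA] := card2_has_other (F2 FA) xA.
have [z xz eB] := card2_has_other (F2 FB) xB.
exists x => C FC; exists x; last by rewrite inE.
apply/negPn/negP => xC.
have [y' ] := disjointN FA FC dA; rewrite eA !inE => /orP[] /eqP ->.
  by rewrite (negPf xC).
move=> yC; have [z' ] := disjointN FB FC dB; rewrite eB !inE => /orP[] /eqP ->.
  by rewrite (negPf xC).
move=> zC; apply: (@F_triangle_free x y z); rewrite -?eA -?eB //.
rewrite -(card2_eq_set2 (F2 FC) yC zC) //.
by apply: contra AB => /eqP yz; rewrite eA eB yz.
Qed.

(* Triangle-freeness is used when some edge meets all others: a second such
   edge forces a star, so otherwise all but one edge have positive degree. *)
Lemma cover_le_disjoint_degree : F != finset.set0 ->
  exists2 S, covers S F &
    (#|F| * #|S| <= #|F| + 2 * \sum_(A in F) disjoint_degree F A).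
Proof.
case/set0Pn=> A0 FA0.
case: (@arg_minnP _ A0 [in F] (disjoint_degree F) FA0) => A /= FA minA.
have [S covS leS] := covers_disjoint_degree F0 FA; rewrite (F2 FA) in leS.
have [dA|dA] := posnP (disjoint_degree F A); last first.
  exists S => //.
  have : #|F| * disjoint_degree F A <= \sum_(B in F) disjoint_degree F B.
    by rewrite -sum_nat_const; apply: leq_sum => B; apply: minA.
  have : #|F| * #|S| <= #|F| * (2 + disjoint_degree F A).
    by rewrite leq_mul2l leS orbT.
  have : (#|F| * 1 <= #|F| * disjoint_degree F A) by rewrite leq_mul2l dA orbT.
  rewrite mulnDr; move: (\sum_(B in F) _) (#|F| * disjoint_degree F A) => s t.
  move: #|F| #|S| => f n; lia.
case: (boolP [exists B in F, (B != A) && (disjoint_degree F B == 0)]).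
  case/exists_inP=> B FB /andP[BA /eqP dB].
  have [x covx] := two_universal_edges FB FA BA dB dA.
  by exists [set x]; rewrite // cards1 muln1 leq_addr.
move/exists_inPn => dF.
have lowD : (#|F|.-1 <= \sum_(B in F) disjoint_degree F B).
  rewrite (bigD1 A) //= dA add0n.
  have -> : #|F|.-1 = (\sum_(B in F | B != A) 1).
    rewrite sum1dep_card.
    have -> : [set B | B \in F & B != A] = F :\ A.
      by apply/setP=> B; rewrite !inE andbC.
    by rewrite (cardsD1 A F) FA.
  apply: leq_sum => B /andP[FB BA].
  by have := dF _ FB; rewrite BA /= -lt0n.
have [F1|F1] := leqP #|F| 1; last first.
  exists S => //; rewrite dA addn0 in leS.
  apply: (@leq_trans (#|F| * 2)); first by rewrite leq_mul2l leS orbT.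
  by move: lowD F1; move: (\sum_(B in F) _) #|F| => s f; lia.
have /set0Pn[x xA] := F0 FA; exists [set x]; last by rewrite cards1 muln1 leq_addr.
move=> B FB; exists x; last by rewrite inE.
have/cards1P[C eF] : #|F| == 1.
  by rewrite eqn_leq F1 card_gt0; apply/set0Pn; exists A.
by move: FA FB; rewrite eF !inE => /eqP <- /eqP ->.
Qed.

End DisjointPairs.

Section Variance.

Variable R : realType.

Lemma sum_sqr_diff (I : finType) (A : {set I}) (a : I -> R) :
  \sum_(i in A) \sum_(j in A) (a i - a j) ^+ 2 =
  2 * (#|A|%:R * \sum_(i in A) a i ^+ 2 - (\sum_(i in A) a i) ^+ 2).
Proof.
have -> : \sum_(i in A) \sum_(j in A) (a i - a j) ^+ 2 =
  \sum_(i in A) (#|A|%:R * a i ^+ 2 - 2 * (a i * \sum_(j in A) a j) +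
                 \sum_(j in A) a j ^+ 2).
  apply: eq_bigr => i _; rewrite mulr_sumr mulr_sumr mulr_natl -sumr_const.
  by rewrite -sumrB -big_split; apply: eq_bigr => j _ /=; ring.
rewrite big_split /= sumrB -!mulr_sumr -mulr_suml sumr_const -[_ *+ #|A|]mulr_natl.
ring.
Qed.

Variables (I : finType) (d : nat) (p : I -> 'rV[R]_d) (A : {set I}).

Lemma sum_sqdistE (c : 'rV[R]_d) :
  \sum_(i in A) \sum_(j in A) sqdist (p i) (p j) =
  2 * (#|A|%:R * \sum_(i in A) sqdist (p i) c -
       \sum_(l < d) (\sum_(i in A) (p i 0 l - c 0 l)) ^+ 2).
Proof.
under eq_bigr do rewrite exchange_big.
rewrite exchange_big /= [in RHS]exchange_big /= mulrBr !mulr_sumr -sumrB.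
apply: eq_bigr => l _.
rewrite -mulrBr -sum_sqr_diff; apply: eq_bigr => i _; apply: eq_bigr => j _.
by congr (_ ^+ 2); ring.
Qed.

Lemma sum_sqdist_le (c : 'rV[R]_d) :
  \sum_(i in A) \sum_(j in A) sqdist (p i) (p j) <=
  2 * (#|A|%:R * \sum_(i in A) sqdist (p i) c).
Proof.
rewrite (sum_sqdistE c) ler_pM2l // lerBlDr lerDl sumr_ge0 // => l _.
exact: sqr_ge0.
Qed.

Definition centroid : 'rV[R]_d := \row_l ((\sum_(i in A) p i 0 l) / #|A|%:R).

Lemma sum_sqdist_centroid : A != finset.set0 ->
  \sum_(i in A) \sum_(j in A) sqdist (p i) (p j) =
  2 * (#|A|%:R * \sum_(i in A) sqdist (p i) centroid).
Proof.
rewrite -card_gt0 => A0; rewrite (sum_sqdistE centroid).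
rewrite [X in _ - X]big1 ?subr0 // => l _.
rewrite sumrB sumr_const mxE -[_ *+ _]mulr_natr divfK ?subrr ?expr0n //.
by rewrite pnatr_eq0 -lt0n.
Qed.

End Variance.

Definition indicator (K : pzSemiRingType) n (A : {set 'I_n}) : 'rV[K]_n :=
  \row_j (j \in A)%:R.

Lemma map_indicator (R : realType) n (A : {set 'I_n}) :
  map_mx ratr (indicator rat A) = indicator R A.
Proof. by apply/rowP => j; rewrite !mxE ratr_nat. Qed.

Lemma indicator_inj n : injective (@indicator rat n).
Proof.
move=> A B /rowP eAB; apply/setP => j; have := eAB j; rewrite !mxE.
by case: (j \in A) (j \in B) => [] [].
Qed.

Section Clusters.

Variables (R : realType) (n : nat).
Implicit Types (A B S : {set 'I_n}) (F : {set {set 'I_n}}).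

Lemma sqdist_indicator A B : #|A| = 2%N -> #|B| = 2%N ->
  sqdist (indicator R A) (indicator R B) =
  2 * ((A != B)%:R + [disjoint A & B]%:R).
Proof.
move=> A2 B2; have cardE (C : {set 'I_n}) : \sum_j (j \in C)%:R = #|C|%:R :> R.
  by rewrite -natr_sum -sum1_card [in RHS]big_mkcond.
have -> : sqdist (indicator R A) (indicator R B) =
    #|A|%:R + #|B|%:R - 2 * #|A :&: B|%:R.
  rewrite -!cardE mulr_sumr -big_split -sumrB; apply: eq_bigr => j _ /=.
  by rewrite !mxE inE; case: (j \in A) (j \in B) => [] [] /=; ring.
rewrite A2 B2 -setI_eq0 -cards_eq0.
have [->|AB] := eqVneq A B; first by rewrite finset.setIid B2 /=; ring.
have : (#|A :&: B| < 2)%N.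
  rewrite ltnNge; apply: contra AB => AB2.
  have eA : A :&: B = A by apply/eqP; rewrite eqEcard finset.subsetIl A2.
  have eB : A :&: B = B by apply/eqP; rewrite eqEcard finset.subsetIr B2.
  by rewrite -{1}eA eB.
by case: #|A :&: B| => [|[|]] //= _; ring.
Qed.

Lemma sum_sqdist_indicator F : (forall A, A \in F -> #|A| = 2%N) ->
  \sum_(A in F) \sum_(B in F) sqdist (indicator R A) (indicator R B) =
  2 * (#|F|%:R * (#|F|%:R - 1) + (\sum_(A in F) disjoint_degree F A)%:R).
Proof.
move=> F2; rewrite natr_sum.
have -> : #|F|%:R * (#|F|%:R - 1) = \sum_(A in F) (#|F|%:R - 1) :> R.
  by rewrite sumr_const -[RHS]mulr_natl.
rewrite -big_split mulr_sumr; apply: eq_bigr => A FA /=.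
have -> : #|F|%:R - 1 = \sum_(B in F) (A != B)%:R :> R.
  rewrite (bigD1 A) //= eqxx add0r.
  rewrite (eq_bigr (fun=> 1)) => [|B /andP[_]]; last by rewrite eq_sym => ->.
  rewrite (eq_bigl [in F :\ A]) => [|B]; last by rewrite !inE andbC.
  by rewrite sumr_const (cardsD1 A F) FA natrD addrAC subrr add0r.
have -> : (disjoint_degree F A)%:R = \sum_(B in F) [disjoint A & B]%:R :> R.
  by rewrite -natr_sum /disjoint_degree -sum1dep_card [in LHS]big_mkcondr.
rewrite -big_split mulr_sumr; apply: eq_bigr => B FB /=.
by rewrite sqdist_indicator ?F2.
Qed.

Lemma cluster_cost_lower F (c : 'rV[R]_n) :
    (forall A, A \in F -> #|A| = 2%N) ->
    (forall x y z, [set x; y] \in F -> [set x; z] \in F -> [set y; z] \in F ->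
      False) ->
  exists2 S, covers S F &
    #|F|%:R - 3 / 2 + #|S|%:R / 2 <= \sum_(A in F) sqdist (indicator R A) c.
Proof.
move=> F2 Ftri; have [->|F0] := eqVneq F finset.set0.
  exists finset.set0; first by move=> A; rewrite inE.
  by rewrite big_set0 !cards0; lra.
have [S covS] := cover_le_disjoint_degree F2 Ftri F0.
exists S => //; have := sum_sqdist_le (@indicator R n) F c.
rewrite sum_sqdist_indicator //; set D := \sum_(A in F) disjoint_degree F A.
set V := \sum_(A in F) _; rewrite ler_pM2l // => leV.
have f0 : 0 < #|F|%:R :> R by rewrite ltr0n card_gt0.
have : #|F|%:R * #|S|%:R <= #|F|%:R + 2 * D%:R :> R.
  by rewrite -!natrM -natrD ler_nat.
move=> leS; rewrite -(ler_pM2l f0); move: leV leS.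
by move: V (#|F|%:R) (#|S|%:R) (D%:R) => V f s D'; nra.
Qed.

Lemma star_cost F x : F != finset.set0 ->
    (forall A, A \in F -> #|A| = 2%N /\ x \in A) ->
  \sum_(A in F) sqdist (indicator R A) (centroid (@indicator R n) F) =
  #|F|%:R - 1.
Proof.
move=> F0 Fx; have := sum_sqdist_centroid (@indicator R n) F0.
rewrite sum_sqdist_indicator => [|A /Fx[]//].
have t0 : (2 : R) != 0 by rewrite pnatr_eq0.
have f0 : #|F|%:R != 0 :> R by rewrite pnatr_eq0 cards_eq0.
rewrite big1 ?addr0 => [/(mulfI t0)/(mulfI f0)->//|A /Fx[_ xA]].
apply/eqP; rewrite cards_eq0; apply/eqP/setP => B; rewrite !inE.
apply/negP => /andP[/Fx[_ xB]] /pred0P/(_ x) /=.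
by rewrite xA xB.
Qed.

End Clusters.

Lemma min_sqdist_attained (R : realType) (J : kmeans_instance)
    (C : centers R J) x : exists i, sqdist x (C i) <= min_sqdist C x.
Proof.
have /bigmin_leP[le|[i _ le]] := lexx (min_sqdist C x); last by exists i.
by exists (Ordinal (km_k_gt0 J)).
Qed.

Section EdgeInstance.

Variables (R : realType) (n k : nat) (k_gt0 : (0 < k)%N).
Variables (pts : seq 'rV[rat]_n) (pts_uniq : uniq pts) (E : {set {set 'I_n}}).
Hypothesis ptsE : perm_eq pts [seq indicator rat A | A <- enum E].
Hypothesis E2 : forall A, A \in E -> #|A| = 2%N.

Let J := KMeansInstance pts_uniq k_gt0.

Lemma kmeans_costE (C : centers R J) :
  kmeans_cost C = \sum_(A in E) min_sqdist C (indicator R A).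
Proof.
rewrite /kmeans_cost (perm_big _ ptsE) big_map big_enum.
by apply: eq_bigr => A _; rewrite map_indicator.
Qed.

Lemma kmeans_cost_lower (C : centers R J) :
    (forall x y z, [set x; y] \in E -> [set x; z] \in E -> [set y; z] \in E ->
      False) ->
  exists2 S, covers S E &
    #|E|%:R - 3 / 2 * k%:R + #|S|%:R / 2 <= kmeans_cost C.
Proof.
move=> Etri.
have [phi phiP] := choice (fun A => min_sqdist_attained C (indicator R A)).
pose F i := [set A in E | phi A == i].
have /choice[S SP] : forall i, exists S, covers S (F i) /\
    #|F i|%:R - 3 / 2 + #|S|%:R / 2 <=
    \sum_(A in F i) sqdist (indicator R A) (C i).
  move=> i; have [A|x y z|S ? ?] := @cluster_cost_lower R n (F i) (C i).
  - by rewrite inE => /andP[/E2].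
  - by rewrite !inE => /andP[exy _] /andP[exz _] /andP[eyz _]; apply: (Etri x y z).
  by exists S.
exists (\bigcup_i S i).
  move=> A EA; have [|x xA xS] := (SP (phi A)).1 A; first by rewrite inE EA /=.
  by exists x => //; apply/bigcupP; exists (phi A).
have leS : (#|\bigcup_i S i|%:R <= \sum_i #|S i|%:R :> R).
  rewrite -natr_sum ler_nat; elim/big_rec2: _ => [|i m B _ IH]; first by rewrite cards0.
  by apply: leq_trans (leq_card_setU _ _) _; rewrite leq_add2l.
have -> : #|E|%:R = \sum_i #|F i|%:R :> R.
  rewrite -natr_sum; congr (_%:R); rewrite -sum1_card (partition_big phi xpredT) //=.
  by apply: eq_bigr => i _; rewrite sum1dep_card.
have -> : kmeans_cost C = \sum_i \sum_(A in F i) min_sqdist C (indicator R A).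
  rewrite kmeans_costE (partition_big phi xpredT) //=.
  by apply: eq_bigr => i _; apply: eq_bigl => A; rewrite inE.
apply: (@le_trans _ _ (\sum_i (#|F i|%:R - 3 / 2 + #|S i|%:R / 2))).
  rewrite big_split sumrB /= sumr_const card_ord -mulr_suml -[_ *+ _]mulr_natr.
  by move: leS; lra.
apply: ler_sum => i _; apply: le_trans (SP i).2 _; apply: ler_sum => A.
by rewrite inE => /andP[_ /eqP <-].
Qed.

(* A partition into stars with as many parts as possible has min(k, #|E|) parts:
   with an unused label, a part with two edges could be split. *)
Lemma star_partition (S : {set 'I_n}) : covers S E -> #|S| = k ->
  exists phi : {ffun {set 'I_n} -> 'I_k},
    (forall i, exists x, forall A, A \in E -> phi A = i -> x \in A) /\
    #|phi @: E| = minn k #|E|.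
Proof.
move=> covS cS; pose x0 (i : 'I_k) : 'I_n := enum_val (cast_ord (esym cS) i).
pose star (phi : {ffun {set 'I_n} -> 'I_k}) :=
  [forall i, exists x, forall A in E, (phi A == i) ==> (x \in A)].
pose i0 : 'I_k := Ordinal k_gt0.
have [phi0 sphi0] : exists phi, star phi.
  exists [ffun A : {set 'I_n} => odflt i0 [pick i | x0 i \in A]].
  apply/forallP => i; apply/existsP; exists (x0 i); apply/forall_inP => A EA.
  rewrite ffunE; case: pickP => [j xj|nox]; first by apply/implyP => /eqP <-.
  have [x xA xS] := covS A EA.
  have := nox (cast_ord cS (enum_rank_in xS x)).
  by rewrite /x0 cast_ordK enum_rankK_in // xA.
case: (@arg_maxnP _ phi0 star (fun phi => #|phi @: E|) sphi0) => phi sphi maxphi.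
exists phi; split.
  move=> i; have /existsP[x /forall_inP xP] := forallP sphi i.
  by exists x => A EA phiA; apply: (implyP (xP A EA)); rewrite phiA.
have lek (U : {set 'I_k}) : (#|U| <= k)%N by have := max_card U; rewrite card_ord.
apply/eqP; rewrite eqn_leq leq_min leq_imset_card lek leqNgt ltn_min.
apply/negP => /andP[ltk ltE].
have [i iphi] : exists i, i \notin phi @: E.
  apply/existsP; rewrite -negb_forall; apply: contraL ltk => /forallP allphi.
  rewrite -leqNgt; apply: (@leq_trans #|'I_k|); first by rewrite card_ord.
  by rewrite -cardsT subset_leq_card //; apply/fintype.subsetP.
have [A [EA [B [EB [AB phiAB]]]]] : exists A, A \in E /\ exists B, B \in E /\
    (A != B /\ phi A = phi B).
  apply: contrapT => noAB; have := ltE; rewrite card_in_imset ?ltnn //.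
  move=> A B EA EB phiAB.
  apply/eqP/negPn/negP => AB; apply: noAB.
  by exists A; split=> //; exists B.
pose psi := [ffun C => if C == A then i else phi C].
have /maxphi : star psi.
  apply/forallP => j; have /existsP[x /forall_inP xP] := forallP sphi j.
  have [ij|ij] := eqVneq i j.
    have /set0Pn[y yA] : A != finset.set0 by rewrite -card_gt0 E2.
    apply/existsP; exists y; apply/forall_inP => C EC; rewrite ffunE.
    have [->|_] := eqVneq C A; first by rewrite yA implybT.
    apply/implyP => /eqP phiC; case/negP: iphi.
    by apply/imsetP; exists C; rewrite // ij.
  apply/existsP; exists x; apply/forall_inP => C EC; rewrite ffunE.
  by have [_|_] := eqVneq C A; [rewrite (negPf ij) | exact: xP].
move=> /=; rewrite leqNgt => /negP; apply.
have -> : psi @: E = i |: phi @: E.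
  apply/setP => j; rewrite !inE; apply/imsetP/orP.
    case=> C EC ->; rewrite ffunE; have [_|_] := eqVneq C A; first by left.
    by right; apply: imset_f.
  case=> [/eqP ->|/imsetP[C EC ->]]; first by exists A; rewrite ?ffunE ?eqxx.
  have [->|CA] := eqVneq C A; last by exists C; rewrite // ffunE (negPf CA).
  by exists B; rewrite // ffunE eq_sym (negPf AB).
by rewrite cardsU1 iphi.
Qed.

Lemma kmeans_cost_upper (S : {set 'I_n}) : covers S E -> #|S| = k ->
  exists C : centers R J, kmeans_cost C <= Num.max 0 (#|E|%:R - k%:R).
Proof.
move=> covS cS; have [phi [stars im]] := star_partition covS cS.
pose F i := [set A in E | phi A == i].
exists (fun i => centroid (@indicator R n) (F i)); set C := (X in kmeans_cost X).
have -> : Num.max 0 (#|E|%:R - k%:R) = #|E|%:R - #|phi @: E|%:R :> R.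
  rewrite im /minn; case: ltnP => [lt|le].
    by apply: max_idPr; rewrite subr_ge0 ler_nat ltnW.
  by rewrite subrr; apply: max_idPl; rewrite subr_le0 ler_nat.
rewrite kmeans_costE (partition_big phi [in phi @: E]) => [|A EA]; last exact: imset_f.
have -> : #|E|%:R - #|phi @: E|%:R = \sum_(i in phi @: E) (#|F i|%:R - 1) :> R.
  rewrite sumrB sumr_const -natr_sum; congr (_%:R - _).
  rewrite -sum1_card (partition_big phi [in phi @: E]) => [|A EA]; last exact: imset_f.
  by apply: eq_bigr => i _; rewrite sum1dep_card.
apply: ler_sum => i /imsetP[A EA phiA]; have [x xP] := stars i.
rewrite -(@star_cost _ _ (F i) x).
- rewrite (eq_bigl [in F i]) => [|B]; last by rewrite inE.
  apply: ler_sum => B _; exact: bigmin_le.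
- by apply/set0Pn; exists A; rewrite inE EA phiA /=.
- by move=> B; rewrite inE => /andP[EB /eqP phiB]; rewrite E2 // (xP B).
Qed.

End EdgeInstance.

(** * The Turing machine *)

Local Open Scope nat_scope.

(* Half-tapes as infinite streams: unlike lists, they make cells beyond the
   written part indistinguishable from explicit blanks. *)
Definition stream := nat -> cell.

Definition blank : stream := fun=> None.

Definition push (a : cell) (s : stream) : stream :=
  fun n => if n is m.+1 then s m else a.

Definition shd (s : stream) : cell := s 0.

Definition stl (s : stream) : stream := fun n => s n.+1.

Fixpoint prepend (w : seq symbol) (s : stream) : stream :=
  if w is a :: w' then push (Some a) (prepend w' s) else s.

Lemma push_blank : push None blank = blank.
Proof. by apply: funext => -[]. Qed.

Lemma push_shd_stl s : push (shd s) (stl s) = s.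
Proof. by apply: funext => -[]. Qed.

Lemma nth_map_Some w : nth None (map Some w) = prepend w blank.
Proof.
elim: w => [|a w IH]; first by apply: funext => n; rewrite nth_nil.
by apply: funext => -[|n] //=; rewrite IH.
Qed.

Record stape := STape { sleft : stream; sright : stream }.

Definition stape_of (t : tape) := STape (nth None (tleft t)) (nth None (tright t)).

Definition sread (t : stape) := shd (sright t).

Definition swrite (a : option cell) (t : stape) :=
  if a is Some x then STape (sleft t) (push x (stl (sright t))) else t.

Definition smove (mv : move) (t : stape) :=
  match mv with
  | MoveL => STape (stl (sleft t)) (push (shd (sleft t)) (sright t))
  | MoveN => t
  | MoveR => STape (push (sread t) (sleft t)) (stl (sright t))
  end.

Lemma stape_of_read t : tread t = sread (stape_of t).
Proof. by case: t => l [|a r]. Qed.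

Lemma stream_behead (r : seq cell) : nth None (behead r) = stl (nth None r).
Proof. by apply: funext => i; rewrite nth_behead. Qed.

Lemma stream_cons (a : cell) r : nth None (a :: r) = push a (nth None r).
Proof. by apply: funext => -[]. Qed.

Lemma stape_of_write a t :
  stape_of (twrite (odflt (tread t) a) t) = swrite a (stape_of t).
Proof.
case: a => [a|]; rewrite /stape_of /twrite /= stream_cons stream_behead //.
by rewrite stape_of_read push_shd_stl.
Qed.

Lemma stape_of_move mv t : stape_of (tmove mv t) = smove mv (stape_of t).
Proof.
case: mv => //=; rewrite /stape_of /= stream_cons stream_behead; by [].
Qed.

Lemma nth_eq_prepend (l : seq cell) w :
  nth None l = prepend w blank -> exists a, l = map Some w ++ nseq a None.
Proof.
elim: w l => [|x w IH] [|a l] /= el.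
- by exists 0.
- exists (size l).+1; apply: (@eq_from_nth _ None); rewrite /= ?size_nseq // => i lti.
  by rewrite el; case: i lti => //= i _; rewrite nth_nseq; case: ifP.
- by have := congr1 (@^~ 0) el.
have [|b ->] := IH l; first by apply: funext => i; have := congr1 (@^~ i.+1) el.
by exists b; have := congr1 (@^~ 0) el; rewrite /= => ->.
Qed.

Lemma stape_of_holds t w :
  stape_of t = STape (prepend (rev w) blank) blank -> tape_holds t w.
Proof.
case: t => l r; rewrite /stape_of /tape_holds /= => -[el er].
have [a ->] := nth_eq_prepend el; have [b ->] := @nth_eq_prepend r [::] er.
exists a, b; rewrite rev_cat catA -map_rev revK; congr ((_ ++ _) ++ _).
by apply: (@eq_from_nth _ None) => [|i]; rewrite ?size_rev // size_nseq => ltia;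
  rewrite nth_rev ?size_nseq // !nth_nseq; case: ifP; case: ifP.
Qed.

Variant qstate :=
  | CopyK | FirstBit | Dim | RewindInput | RewindRow | SkipTo | Scan
  | RewindEdge | Emit | Emit1 | EmitSep | EmitDen | EmitEnd | Return
  | FindMark | SetMark | Halt.

Definition qstate_code q : 'I_17 := inord
  match q with
  | CopyK => 0 | FirstBit => 1 | Dim => 2 | RewindInput => 3 | RewindRow => 4
  | SkipTo => 5 | Scan => 6 | RewindEdge => 7 | Emit => 8 | Emit1 => 9
  | EmitSep => 10 | EmitDen => 11 | EmitEnd => 12 | Return => 13
  | FindMark => 14 | SetMark => 15 | Halt => 16
  end.

Definition qstate_decode (i : 'I_17) :=
  nth Halt [:: CopyK; FirstBit; Dim; RewindInput; RewindRow; SkipTo; Scan;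
    RewindEdge; Emit; Emit1; EmitSep; EmitDen; EmitEnd; Return; FindMark;
    SetMark; Halt] i.

Lemma qstate_codeK : cancel qstate_code qstate_decode.
Proof. by case; rewrite /qstate_code /qstate_decode inordK. Qed.

HB.instance Definition _ := Finite.copy qstate (can_type qstate_codeK).

Definition action := (option cell * move)%type.

Definition stay : action := (None, MoveN).
Definition go_left : action := (None, MoveL).
Definition go_right : action := (None, MoveR).
Definition put (a : symbol) : action := (Some (Some a), MoveR).
Definition set_left (a : symbol) : action := (Some (Some a), MoveL).

(* The cells scanned on, and the actions for, the input, output and work tapes.
   The work tape holds the row number u as a [Bit true] among [Bit false]; while
   the edge uv is emitted, cell v is a [Sep]. *)
Definition delta (q : qstate) (i o w : cell) : qstate * (action * action * action) :=
  match q with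
  | CopyK => match i with
      | Some (Bit b) => (CopyK, (go_right, put (Bit b), stay))
      | _ => (FirstBit, (go_right, put Sep, stay))
      end
  | FirstBit => match i with
      | None => (Halt, (stay, put Sep, stay))
      | _ => (Dim, (go_right, put (Bit true), put (Bit true)))
      end
  | Dim => match i with
      | Some (Bit b) => (Dim, (go_right, put (Bit true), put (Bit false)))
      | _ => (RewindInput, (go_left, put Sep, go_left))
      end
  | RewindInput => match i with
      | Some (Bit b) => (RewindInput, (go_left, stay, stay))
      | _ => (RewindRow, (go_right, stay, stay))
      end
  | RewindRow => match w with
      | None => (SkipTo, (stay, stay, go_right))
      | _ => (RewindRow, (stay, stay, go_left))
      end
  | SkipTo => match w with
      | Some (Bit false) => (SkipTo, (go_right, stay, go_right))
      | _ => (Scan, (go_right, stay, go_right))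
      end
  | Scan => match i with
      | Some (Bit false) => (Scan, (go_right, stay, go_right))
      | Some (Bit true) => (RewindEdge, (stay, stay, set_left Sep))
      | _ => (FindMark, (go_right, stay, go_left))
      end
  | RewindEdge => match w with
      | None => (Emit, (stay, stay, go_right))
      | _ => (RewindEdge, (stay, stay, go_left))
      end
  | Emit => match w with
      | None => (Return, (stay, put Sep, go_left))
      | Some (Bit false) => (EmitSep, (stay, put (Bit false), stay))
      | _ => (Emit1, (stay, put (Bit false), stay))
      end
  | Emit1 => (EmitSep, (stay, put (Bit true), stay))
  | EmitSep => (EmitDen, (stay, put Sep, stay))
  | EmitDen => (EmitEnd, (stay, put (Bit true), stay))
  | EmitEnd => (Emit, (stay, put Sep, go_right))
  | Return => match w with
      | Some Sep => (Scan, (go_right, stay, put (Bit false)))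
      | _ => (Return, (stay, stay, go_left))
      end
  | FindMark => match w with
      | Some (Bit true) => (SetMark, (stay, stay, put (Bit false)))
      | _ => (FindMark, (stay, stay, go_left))
      end
  | SetMark => match w with
      | None => (Halt, (stay, stay, stay))
      | _ => (RewindRow, (stay, stay, set_left (Bit true)))
      end
  | Halt => (Halt, (stay, stay, stay))
  end.

Definition halted q := if q is Halt then true else false.

(* Tape [None] is the input, [Some false] the output, [Some true] the work tape. *)
Definition reduction_TM : TM :=
  @MkTM qstate (option bool) CopyK halted None (Some false)
    (fun q rd =>
       let: (q', (ai, ao, aw)) :=
         delta q (rd None) (rd (Some false)) (rd (Some true)) in
       (q', fun t =>
          let: (a, mv) :=
            match t with None => ai | Some false => ao | Some true => aw end in
          (odflt (rd t) a, mv))).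

Record sconfig :=
  SConfig { sstate : qstate; sin : stape; sout : stape; swork : stape }.

Definition act (a : action) (t : stape) := smove a.2 (swrite a.1 t).

Definition sstep (c : sconfig) : sconfig :=
  let: SConfig q i o w := c in
  let: (q', (ai, ao, aw)) := delta q (sread i) (sread o) (sread w) in
  SConfig q' (act ai i) (act ao o) (act aw w).

Definition sconfig_of (c : config reduction_TM) : sconfig :=
  SConfig (cstate c : qstate) (stape_of (ctape c None)) (stape_of (ctape c (Some false)))
    (stape_of (ctape c (Some true))).

Lemma sconfig_of_step c : sconfig_of (tm_step c) = sstep (sconfig_of c).
Proof.
case: c => q tp; rewrite /sstep [sconfig_of (Config _ _)]/sconfig_of -!stape_of_read.
rewrite /tm_step /=; case: ifP => [|_]; first by case: q.
case: delta => q' [[[ai mi] [ao mo]] [aw mw]].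
by rewrite /sconfig_of /= !stape_of_move !stape_of_write.
Qed.

Lemma sconfig_of_iter t c :
  sconfig_of (iter t (@tm_step reduction_TM) c) = iter t sstep (sconfig_of c).
Proof. by elim: t => //= t <-; rewrite sconfig_of_step. Qed.

Lemma sconfig_of_init w : sconfig_of (init_config reduction_TM w) =
  SConfig CopyK (STape blank (prepend w blank)) (STape blank blank) (STape blank blank).
Proof.
rewrite /sconfig_of /init_config /stape_of /= nth_map_Some.
have -> // : nth None [::] = blank by apply: funext => i; rewrite nth_nil.
Qed.

Definition reach (t : nat) (c c' : sconfig) :=
  exists2 n, n <= t & iter n sstep c = c'.

Lemma reach0 c : reach 0 c c.
Proof. by exists 0. Qed.

Lemma reachW t t' c c' : t <= t' -> reach t c c' -> reach t' c c'.
Proof. by move=> le [n len e]; exists n => //; apply: leq_trans le. Qed.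

Lemma reach_trans t1 t2 a b c : reach t1 a b -> reach t2 b c -> reach (t1 + t2) a c.
Proof.
move=> [n1 le1 e1] [n2 le2 e2]; exists (n2 + n1); first by rewrite addnC leq_add.
by rewrite iterD e1.
Qed.

Lemma reach_step t c c' : reach t (sstep c) c' -> reach t.+1 c c'.
Proof. by move=> [n le e]; exists n.+1; rewrite // iterSr. Qed.

Lemma iter_halt n i o w : iter n sstep (SConfig Halt i o w) = SConfig Halt i o w.
Proof. by elim: n => //= n ->. Qed.

Lemma reach_computes t w v i wk :
    reach t (SConfig CopyK (STape blank (prepend w blank)) (STape blank blank)
               (STape blank blank))
      (SConfig Halt i (STape (prepend (rev v) blank) blank) wk) ->
  computes_within reduction_TM w v t.
Proof.
case=> n le; rewrite -sconfig_of_init -sconfig_of_iter => e.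
have : sconfig_of (iter t (@tm_step reduction_TM) (init_config reduction_TM w)) =
       SConfig Halt i (STape (prepend (rev v) blank) blank) wk.
  by rewrite -(subnK le) iterD sconfig_of_iter e iter_halt.
rewrite /computes_within; move: (iter t _ _) => c ec.
split; [by rewrite -[cstate c]/(sstate (sconfig_of c)) ec |].
exact: stape_of_holds (congr1 sout ec).
Qed.

Definition wtape (l r : seq symbol) := STape (prepend l blank) (prepend r blank).

(* The word written so far is kept reversed. *)
Definition out (r : seq symbol) := wtape r [::].

Notation zeros n := (nseq n (Bit false)).

Lemma catrev_nseq (T : Type) n (x : T) s : catrev (nseq n x) s = nseq n x ++ s.
Proof.
by elim: n s => //= n IH s; rewrite {}IH; elim: n => //= n ->.
Qed.

Lemma run_copy kb li rest r w :
  reach (size kb).+1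
    (SConfig CopyK (wtape li (map Bit kb ++ Sep :: rest)) (out r) w)
    (SConfig FirstBit (wtape (Sep :: catrev (map Bit kb) li) rest)
       (out (catrev (rcons (map Bit kb) Sep) r)) w).
Proof.
elim: kb li r => [|b kb IH] li r; apply: reach_step; first exact: reach0.
exact: (IH (Bit b :: li) (Bit b :: r)).
Qed.

Lemma run_dim bs li rest r lw :
  reach (size bs)
    (SConfig Dim (wtape li (map Bit bs ++ rest)) (out r) (wtape lw [::]))
    (SConfig Dim (wtape (catrev (map Bit bs) li) rest)
       (out (catrev (nseq (size bs) (Bit true)) r))
       (wtape (zeros (size bs) ++ lw) [::])).
Proof.
rewrite -catrev_nseq; elim: bs li r lw => [|b bs IH] li r lw; first exact: reach0.
apply: reach_step; exact: (IH (Bit b :: li) (Bit true :: r) (Bit false :: lw)).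
Qed.

Lemma run_rewind_input bs li rest o w :
  reach (size bs).+1
    (SConfig RewindInput (smove MoveL (wtape (map Bit bs ++ Sep :: li) rest)) o w)
    (SConfig RewindRow (wtape (Sep :: li) (catrev (map Bit bs) rest)) o w).
Proof.
elim: bs rest => [|b bs IH] rest; apply: reach_step; first exact: reach0.
exact: (IH (Bit b :: rest)).
Qed.

Lemma run_rewind q q' lw rw i o :
    (forall a b, delta q a b None = (q', (stay, stay, go_right))) ->
    (forall a b x, delta q a b (Some x) = (q, (stay, stay, go_left))) ->
  reach (size lw).+1 (SConfig q i o (smove MoveL (wtape lw rw)))
    (SConfig q' i o (wtape [::] (catrev lw rw))).
Proof.
move=> qN qS; elim: lw rw => [|a lw IH] rw; apply: reach_step.
  by rewrite /sstep qN /act /= -[stl _]/blank push_blank; apply: reach0.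
by rewrite /sstep qS; apply: (IH (a :: rw)).
Qed.

Lemma run_skip bs li rest o lw rw :
  reach (size bs)
    (SConfig SkipTo (wtape li (map Bit bs ++ rest)) o
       (wtape lw (zeros (size bs) ++ rw)))
    (SConfig SkipTo (wtape (catrev (map Bit bs) li) rest) o
       (wtape (zeros (size bs) ++ lw) rw)).
Proof.
rewrite -[X in wtape X rw]catrev_nseq.
elim: bs li lw => [|b bs IH] li lw; first exact: reach0.
apply: reach_step; exact: (IH (Bit b :: li) (Bit false :: lw)).
Qed.

Definition emit_coord (s : symbol) :=
  if s is Bit false then [:: Bit false; Sep; Bit true; Sep]
  else [:: Bit false; Bit true; Sep; Bit true; Sep].

Lemma run_emit ws i r lw :
  reach (5 * size ws) (SConfig Emit i (out r) (wtape lw ws))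
    (SConfig Emit i (out (catrev (flatten (map emit_coord ws)) r))
       (wtape (catrev ws lw) [::])).
Proof.
elim: ws r lw => [|s ws IH] r lw; first exact: reach0.
rewrite mulnS /= catrev_catl.
apply: reach_trans (IH (catrev (emit_coord s) r) (s :: lw)).
case: s => [[]|]; first by do 5!apply: reach_step; exact: reach0.
  by apply: (@reachW 4) => //; do 4!apply: reach_step; exact: reach0.
by do 5!apply: reach_step; exact: reach0.
Qed.

Lemma run_return p lw rw li b rest o :
  reach p.+1
    (SConfig Return (wtape li (b :: rest)) o
       (smove MoveL (wtape (zeros p ++ Sep :: lw) rw)))
    (SConfig Scan (wtape (b :: li) rest) o (wtape (Bit false :: lw) (zeros p ++ rw))).
Proof.
rewrite -[zeros p ++ rw]catrev_nseq.
elim: p rw => [|p IH] rw; apply: reach_step; first exact: reach0.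
exact: (IH (Bit false :: rw)).
Qed.

Definition edge_out lw p :=
  rcons (flatten (map emit_coord (catrev lw (Sep :: zeros p)))) Sep.

Lemma run_edge li rest r lw p :
  reach (9 * (size lw + p.+1))
    (SConfig Scan (wtape li (Bit true :: rest)) (out r) (wtape lw (zeros p.+1)))
    (SConfig Scan (wtape (Bit true :: li) rest) (out (catrev (edge_out lw p) r))
       (wtape (Bit false :: lw) (zeros p))).
Proof.
set N := size lw + p.+1.
have sz : size (catrev lw (Sep :: zeros p)) = N.
  by rewrite catrevE size_cat size_rev /= size_nseq.
apply: (@reachW ((size lw).+1 + (5 * N + p.+2)).+1); first by rewrite /N; lia.
have ret := @run_return p lw [::] li (Bit true) rest (out (catrev (edge_out lw p) r)).
apply: reach_step.
apply: reach_trans (@run_rewind RewindEdge Emit lw (Sep :: zeros p)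
  (wtape li (Bit true :: rest)) (out r) _ _) _ => //.
rewrite -sz; apply: reach_trans (run_emit _ _ _ _) _.
have -> : catrev (catrev lw (Sep :: zeros p)) [::] = zeros p ++ Sep :: lw.
  by rewrite (catrevE lw) catrev_catl /= catrev_nseq -/(rev _) revK.
by apply: reach_step; rewrite cats0 /edge_out -cats1 catrev_catl in ret *.
Qed.

Fixpoint scan_out (lw : seq symbol) (bs : seq bool) : seq symbol :=
  if bs is b :: bs' then
    (if b then edge_out lw (size bs') else [::]) ++ scan_out (Bit false :: lw) bs'
  else [::].

Lemma run_scan bs li rest r lw :
  reach (size bs * (9 * (size lw + size bs)))
    (SConfig Scan (wtape li (map Bit bs ++ rest)) (out r) (wtape lw (zeros (size bs))))
    (SConfig Scan (wtape (catrev (map Bit bs) li) rest)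
       (out (catrev (scan_out lw bs) r))
       (wtape (zeros (size bs) ++ lw) [::])).
Proof.
rewrite -catrev_nseq.
elim: bs li r lw => [|b bs IH] li r lw; first exact: reach0.
rewrite [scan_out _ _]/= catrev_catl.
have := IH (Bit b :: li) (catrev (if b then edge_out lw (size bs) else [::]) r)
  (Bit false :: lw).
rewrite [size (_ :: lw)]/= addSnnS [size (b :: bs)]/= mulSn => /(reach_trans _).
apply; case: b; first exact: run_edge.
by apply: (@reachW 1); [lia | apply: reach_step; exact: reach0].
Qed.

Lemma run_find_mark p lw rw i o :
  reach p.+1
    (SConfig FindMark i o (smove MoveL (wtape (zeros p ++ Bit true :: lw) rw)))
    (SConfig SetMark i o (wtape (Bit false :: lw) (zeros p ++ rw))).
Proof.
rewrite -[zeros p ++ rw]catrev_nseq.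
elim: p rw => [|p IH] rw; apply: reach_step; first exact: reach0.
exact: (IH (Bit false :: rw)).
Qed.

Definition row_out u bs := scan_out (Bit true :: zeros u) (drop u.+1 bs).

Lemma run_row u p bs li rest r : size bs = u + p.+1 ->
  exists li', reach (11 * (u + p.+1) ^ 2)
    (SConfig SkipTo (wtape li (map Bit bs ++ Sep :: rest)) (out r)
       (wtape [::] (zeros u ++ Bit true :: zeros p)))
    (SConfig SetMark (wtape li' rest) (out (catrev (row_out u bs) r))
       (wtape (zeros u.+1) (zeros p))).
Proof.
move=> sz; have e : bs = take u bs ++ nth false bs u :: drop u.+1 bs.
  by rewrite -drop_nth ?cat_take_drop // sz; lia.
have s1 : size (take u bs) = u by rewrite size_takel // sz; lia.
have s2 : size (drop u.+1 bs) = p by rewrite size_drop sz; lia.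
rewrite /row_out; move: s1 s2 e.
move: (take u bs) (nth false bs u) (drop u.+1 bs) => bs1 b bs2 s1 s2 ->.
rewrite map_cat -catA /=.
set r' := catrev _ r.
pose li' := catrev (map Bit bs2) (Bit b :: catrev (map Bit bs1) li).
have mark := @run_find_mark p (zeros u) [::] (wtape (Sep :: li') rest) (out r').
rewrite cats0 in mark; exists (Sep :: li').
apply: (@reachW (u + (p * (9 * (u.+1 + p)) + p.+2).+1)); first by rewrite -mulnn; nia.
have skip := @run_skip bs1 li (Bit b :: map Bit bs2 ++ Sep :: rest) (out r) [::]
  (Bit true :: zeros p).
rewrite s1 cats0 in skip; apply: reach_trans skip _; apply: reach_step.
have scan := @run_scan bs2 (Bit b :: catrev (map Bit bs1) li) (Sep :: rest) r
  (Bit true :: zeros u).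
rewrite /= size_nseq s2 in scan; apply: reach_trans scan _.
by apply: reach_step; exact: mark.
Qed.

Definition rows_in (rs : seq (seq bool)) :=
  flatten [seq rcons (map Bit bs) Sep | bs <- rs].

Fixpoint rows_out u (rs : seq (seq bool)) : seq symbol :=
  if rs is bs :: rs' then row_out u bs ++ rows_out u.+1 rs' else [::].

Lemma run_rows N u rs li r : u + size rs = N -> 0 < size rs ->
    all (fun bs => size bs == N) rs ->
  exists i w, reach (size rs * (13 * N ^ 2))
    (SConfig SkipTo (wtape li (rows_in rs)) (out r)
       (wtape [::] (zeros u ++ Bit true :: zeros (size rs).-1)))
    (SConfig Halt i (out (catrev (rows_out u rs) r)) w).
Proof.
elim: rs u li r => //= bs rs IH u li r uN _ /andP[/eqP szbs szrs].
rewrite /rows_in /= cat_rcons catrev_catl.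
have szbs' : size bs = u + (size rs).+1 by rewrite szbs uN.
have [li' row] := run_row li (rows_in rs) r szbs'; rewrite uN in row.
have [rs0|rs_gt0] := posnP (size rs).
  exists (wtape li' (rows_in rs)), (wtape (zeros u.+1) [::]).
  apply: (@reachW (11 * N ^ 2 + 1)); first by rewrite -mulnn; nia.
  apply: reach_trans row _; rewrite (size0nil rs0).
  by apply: reach_step; apply: reach0.
have [|i [w rows]] := IH u.+1 li' (catrev (row_out u bs) r) _ rs_gt0 szrs; first by lia.
exists i, w; rewrite mulSn.
apply: (@reachW ((11 * N ^ 2 + u.+2.+1) + size rs * (13 * N ^ 2))).
  by rewrite leq_add2r -mulnn; nia.
apply: reach_trans rows; apply: reach_trans row _.
rewrite -(prednK rs_gt0); apply: reach_step.
have := @run_rewind RewindRow SkipTo (zeros u.+1) (Bit true :: zeros (size rs).-1)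
  (wtape li' (rows_in rs)) (out (catrev (row_out u bs) r)).
by rewrite size_nseq catrev_nseq => /(_ (fun _ _ => erefl) (fun _ _ _ => erefl)).
Qed.

Definition machine_in kb rs := map Bit kb ++ Sep :: rows_in rs.

Definition machine_out kb rs :=
  map Bit kb ++ Sep :: nseq (size rs) (Bit true) ++ Sep :: rows_out 0 rs.

Lemma reduction_TM_correct kb rs : all (fun bs => size bs == size rs) rs ->
  computes_within reduction_TM (machine_in kb rs) (machine_out kb rs)
    (20 * size (machine_in kb rs) ^ 3 + 20).
Proof.
move=> szrs; set t := (_ + 20).
suff [i [w run]] : exists i w, reach t
    (SConfig CopyK (wtape [::] (machine_in kb rs)) (out [::]) (wtape [::] [::]))
    (SConfig Halt i (out (catrev (machine_out kb rs) [::])) w).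
  exact: reach_computes run.
have copy := @run_copy kb [::] (rows_in rs) [::] (wtape [::] [::]).
rewrite /machine_out -cat_rcons catrev_catl.
set r1 := catrev (rcons _ _) _ in copy *.
have lek : size kb < size (machine_in kb rs).
  by rewrite size_cat size_map /= addnS ltnS leq_addr.
case: rs szrs @t copy lek => [|bs rs] szrs t copy lek.
  do 2!eexists; apply: (@reachW ((size kb).+1 + 1)).
    by rewrite /t; move: lek; set S := size _; rewrite !expnS; nia.
  by apply: reach_trans copy _; apply: reach_step; apply: reach0.
have szbs : size bs = (size rs).+1 by have /andP[/eqP] := szrs.
case: bs szbs szrs @t copy lek => // b bs szbs szrs t copy lek.
set n := size (_ :: rs) in szrs *.
set lk := catrev (map Bit kb) [::] in copy.
have ein : rows_in ((b :: bs) :: rs) = Bit b :: map Bit bs ++ Sep :: rows_in rs.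
  by rewrite /rows_in /= cat_rcons.
have len : n < size (machine_in kb ((b :: bs) :: rs)).
  rewrite /machine_in ein size_cat /= size_cat /= !size_map.
  by rewrite -[n]/((size rs).+1) -szbs /=; lia.
have dim := @run_dim bs (Bit b :: Sep :: lk) (Sep :: rows_in rs) (Bit true :: r1)
  [:: Bit true].
have einput : catrev (map Bit bs) (Bit b :: Sep :: lk) =
              map Bit (rev (b :: bs)) ++ Sep :: lk.
  by rewrite map_rev catrevE rev_cons cat_rcons.
rewrite einput in dim.
set r2 := catrev (nseq (size bs) _) _ in dim.
have er2 : catrev (nseq n (Bit true) ++ Sep :: rows_out 0 ((b :: bs) :: rs)) r1 =
           catrev (rows_out 0 ((b :: bs) :: rs)) (Sep :: r2).
  by rewrite -[n]/((size rs).+1) -szbs catrev_catl.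
rewrite er2.
have back := @run_rewind_input (rev (b :: bs)) lk (Sep :: rows_in rs) (out (Sep :: r2))
  (smove MoveL (wtape (zeros (size bs) ++ [:: Bit true]) [::])).
rewrite size_rev catrevE -map_rev revK in back.
have rew := @run_rewind RewindRow SkipTo (zeros (size bs) ++ [:: Bit true]) [::]
  (wtape (Sep :: lk) (map Bit (b :: bs) ++ Sep :: rows_in rs)) (out (Sep :: r2))
  (fun _ _ => erefl) (fun _ _ _ => erefl).
have [i [w rows]] := @run_rows n 0 ((b :: bs) :: rs) (Sep :: lk) (Sep :: r2)
  erefl isT szrs.
exists i, w.
apply: (@reachW ((size kb).+1 + (size bs + ((size (b :: bs)).+1 +
  (size (zeros (size bs) ++ [:: Bit true])).+1).+1).+1 + n * (13 * n ^ 2))).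
  have -> : size (b :: bs) = n by [].
  have -> : size bs = n.-1 by case: szbs.
  rewrite size_cat size_nseq addn1 (_ : n.-1.+1 = n) //.
  rewrite /t; move: lek len; move: (size (machine_in _ _)) (size kb) => S k lek len.
  have : n * (13 * n ^ 2) <= 13 * S ^ 3.
    rewrite -[n * _]mulnC -mulnA -expnSr leq_mul2l /= leq_exp2r //; exact: ltnW.
  by have : S <= S ^ 3 by [rewrite !expnS; nia]; lia.
apply: reach_trans rows; apply: reach_trans copy _; rewrite ein.
apply: reach_step; apply: reach_trans dim _; apply: reach_step.
apply: reach_trans back _; rewrite catrev_catl catrev_nseq cats0 in rew.
have ers : size bs = size rs by case: szbs.
by rewrite [zeros 0 ++ _]/= -ers.
Qed.

(** * The reduction *)

Local Open Scope ring_scope.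

Section EdgeList.

Variable G : sgraph.
Let n := gorder G.
Implicit Types (u v : 'I_n) (A S : {set 'I_n}).

Lemma adj_neq u v : adj u v -> u != v.
Proof. by move=> uv; apply/eqP => e; rewrite e adj_irr in uv. Qed.

Lemma edgesP A : reflect (exists u v, adj u v /\ A = [set u; v]) (A \in edges G).
Proof.
rewrite inE; apply: (iffP existsP) => [[u /existsP[v /andP[uv /eqP ->]]]|].
  by exists u, v.
by case=> u [v [uv ->]]; exists u; apply/existsP; exists v; rewrite uv eqxx.
Qed.

Lemma edges_card2 A : A \in edges G -> #|A| = 2%N.
Proof. by case/edgesP=> u [v [/adj_neq uv ->]]; rewrite cards2 uv. Qed.

Lemma mem_edges u v : ([set u; v] \in edges G) = adj u v.
Proof.
apply/edgesP/idP => [[x [y [xy e]]]|uv]; last by exists u, v.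
have xuv : x \in [set u; v] by rewrite e !inE eqxx.
have yuv : y \in [set u; v] by rewrite e !inE eqxx orbT.
move: xuv yuv; rewrite !inE.
case/orP=> /eqP ex /orP[] /eqP ey; move: xy; rewrite ex ey ?adj_irr //.
by rewrite adj_sym.
Qed.

Lemma covers_edges S : covers S (edges G) <-> vertex_cover S.
Proof.
split=> [cov u v uv|vc A /edgesP[u [v [uv ->]]]].
  have [|x] := cov [set u; v]; first by rewrite mem_edges.
  by rewrite !inE => /orP[] /eqP ->; [left | right].
by case: (vc u v uv) => ?; [exists u | exists v]; rewrite // !inE eqxx ?orbT.
Qed.

Lemma edges_triangle_free x y z : triangle_free G ->
  [set x; y] \in edges G -> [set x; z] \in edges G -> [set y; z] \in edges G ->
  False.
Proof.
rewrite !mem_edges => tf xy xz yz; apply: (tf x y z); split=> //.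
by rewrite adj_sym.
Qed.

Definition edge_list : seq {set 'I_n} :=
  [seq [set u; v] | u <- enum 'I_n,
                    v <- [seq v : 'I_n <- enum 'I_n | (u < v)%N && adj u v]].

Lemma mem_edge_list A : (A \in edge_list) = (A \in edges G).
Proof.
apply/allpairsPdep/edgesP => [[u [v [_]]]|[u [v [uv eA]]]].
  by rewrite mem_filter => /andP[/andP[_ uv] _] ->; exists u, v.
have [lt|lt|e] := ssrnat.ltngtP u v.
- by exists u, v; rewrite mem_enum; split; rewrite // mem_filter lt uv mem_enum.
- exists v, u; rewrite mem_enum; split; rewrite ?eA 1?finset.setUC //.
  by rewrite mem_filter lt adj_sym uv mem_enum.
- by have := adj_neq uv; rewrite (val_inj e) eqxx.
Qed.

Lemma uniq_edge_list : uniq edge_list.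
Proof.
apply: allpairs_uniq_dep => [|u _|]; [exact: enum_uniq| |].
  exact/filter_uniq/enum_uniq.
move=> _ _ /allpairsPdep[u [v [_ + ->]]] /allpairsPdep[u' [v' [_ + ->]]] /=.
rewrite !mem_filter => /andP[/andP[lt _] _] /andP[/andP[lt' _] _] e.
have : (u \in [set u'; v']) && (v \in [set u'; v']).
  by rewrite -e !inE !eqxx orbT.
rewrite !inE => /andP[/orP[] /eqP eu /orP[] /eqP ev]; subst => //; lia.
Qed.

Lemma perm_edge_list : perm_eq edge_list (enum (edges G)).
Proof.
apply: uniq_perm; rewrite ?uniq_edge_list ?enum_uniq // => A.
by rewrite mem_edge_list mem_enum.
Qed.

End EdgeList.

Lemma uniq_edge_points G : uniq [seq indicator rat A | A <- edge_list G].
Proof. by rewrite map_inj_uniq ?uniq_edge_list //; apply: indicator_inj. Qed.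

Definition reduction (I : vc_instance) : kmeans_instance :=
  KMeansInstance (uniq_edge_points (vc_graph I)) (vc_k_gt0 I).

Local Open Scope nat_scope.

Lemma map_val_enum_drop n k : map val (drop k (enum 'I_n)) = iota k (n - k).
Proof. by rewrite map_drop val_enum_ord drop_iota. Qed.

Lemma encode_rat_bool (b : bool) : encode_rat b%:R%R = emit_coord (Bit b).
Proof. by case: b. Qed.

Lemma map_marks_iota (T : Type) (x y z : T) u m p :
  [seq if j == u then x else if j == u + m.+1 then y else z
     | j <- iota 0 (u + (m + p.+1).+1)] =
  nseq u z ++ x :: nseq m z ++ y :: nseq p z.
Proof.
set f := fun j => _.
have const k l : (forall j, k <= j < k + l -> f j = z) ->
    map f (iota k l) = nseq l z.
  by elim: l k => //= l IH k fz; rewrite fz ?IH // => [j ?|]; rewrite ?fz //; lia.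
rewrite iotaD map_cat /= add0n iotaD map_cat /= !const; rewrite /f; last 3 first.
- by move=> j jP; rewrite !ifN //; lia.
- by move=> j jP; rewrite !ifN //; lia.
- by move=> j jP; rewrite !ifN //; lia.
by rewrite eqxx addSnnS eqxx; case: eqP => // e; lia.
Qed.

Lemma encode_point_edge n (u v : 'I_n) m p :
    v = u + m.+1 :> nat -> n = u + (m + p.+1).+1 ->
  encode_point (indicator rat [set u; v]) =
  edge_out (nseq m (Bit false) ++ Bit true :: nseq u (Bit false)) p.
Proof.
move=> ev en; rewrite /encode_point /edge_out; congr rcons.
have -> : catrev (nseq m (Bit false) ++ Bit true :: nseq u (Bit false))
            (Sep :: nseq p (Bit false)) =
          [seq if j == u :> nat then Bit true else
               if j == v :> nat then Sep else Bit false | j <- map val (enum 'I_n)].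
  by rewrite val_enum_ord ev [X in iota 0 X]en map_marks_iota catrev_catl /=
    !catrev_nseq.
rewrite -!map_comp; congr flatten; apply: eq_map => j /=.
rewrite mxE encode_rat_bool !inE !val_eqE.
by case: eqVneq => //= _; case: eqVneq.
Qed.

Lemma scan_out_edges n (u : 'I_n) m (a : pred 'I_n) s :
    map val s = iota (u + m.+1) (size s) -> u + m.+1 + size s = n ->
  scan_out (nseq m (Bit false) ++ Bit true :: nseq u (Bit false)) (map a s) =
  flatten [seq encode_point (indicator rat [set u; v]) | v <- s & a v].
Proof.
elim: s m => //= v s IH m [ev es] en.
rewrite (IH m.+1); [|by rewrite addnS|by move: en => /=; lia].
by case: ifP => //= _; rewrite size_map (@encode_point_edge _ u v m (size s)) //; lia.
Qed.

Lemma row_out_edges n (u : 'I_n) (a : pred 'I_n) :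
  row_out u (map a (enum 'I_n)) =
  flatten [seq encode_point (indicator rat [set u; v])
             | v : 'I_n <- enum 'I_n & (u < v) && a v].
Proof.
have sz : size (drop u.+1 (enum 'I_n)) = n - u.+1.
  by rewrite size_drop size_enum_ord.
rewrite /row_out -map_drop -[_ :: _]cat0s (@scan_out_edges _ u 0); last 2 first.
- by rewrite sz addn1 map_val_enum_drop.
- by rewrite sz addn1 subnKC.
congr (flatten (map _ _)); rewrite -{2}(cat_take_drop u.+1 (enum 'I_n)) filter_cat.
rewrite (_ : seq.filter _ (take _ _) = [::]) ?cat0s.
  apply: eq_in_filter => v /(map_f val); rewrite map_val_enum_drop mem_iota.
  by case/andP=> ->.
apply/eqP; rewrite -[_ == _]negbK -has_filter; apply/hasPn => v /(map_f val).
rewrite map_take val_enum_ord take_iota mem_iota /= negb_and -leqNgt => ltv.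
by apply/orP; left; lia.
Qed.

Lemma rows_out_edges n (a : rel 'I_n) k s : map val s = iota k (size s) ->
  rows_out k [seq map (a u) (enum 'I_n) | u <- s] =
  flatten [seq flatten [seq encode_point (indicator rat [set u; v])
                          | v : 'I_n <- enum 'I_n & (u < v) && a u v] | u : 'I_n <- s].
Proof.
elim: s k => //= u s IH k [<- es].
by rewrite row_out_edges IH.
Qed.

Lemma flatten_map_flatten (T T1 T2 : Type) (f : T1 -> seq T2) (g : T -> seq T1) s :
  flatten (map f (flatten (map g s))) = flatten [seq flatten (map f (g u)) | u <- s].
Proof. by elim: s => //= u s IH; rewrite map_cat flatten_cat IH. Qed.

Lemma reduction_polytime : polytime_computable encode_vc encode_kmeans reduction.
Proof.
exists reduction_TM, 20, 3 => I; set G := vc_graph I; set n := gorder G.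
pose kb := if bin_of_nat (vc_k I) is BinNums.Npos p then bits_pos p else [::].
pose rs := [seq map (@adj G u) (enum 'I_n) | u <- enum 'I_n].
have sz : size rs = n by rewrite size_map size_enum_ord.
have -> : encode_vc I = machine_in kb rs.
  rewrite /encode_vc /machine_in /rows_in.
  rewrite -[encode_nat _]/(map Bit kb); congr (_ ++ Sep :: flatten _).
  rewrite -[RHS]map_comp; apply: eq_map => u /=; congr rcons.
  by rewrite -[RHS]map_comp.
have -> : encode_kmeans (reduction I) = machine_out kb rs.
  rewrite /encode_kmeans /machine_out sz /rs rows_out_edges; last first.
    by rewrite val_enum_ord size_enum_ord.
  rewrite -[encode_nat _]/(map Bit kb); congr (_ ++ Sep :: _ ++ Sep :: _).
  rewrite -[[seq encode_point x | x <- _]]map_comp flatten_map_flatten.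
  by congr flatten; apply: eq_map => u; rewrite -[X in flatten X]map_comp.
apply: reduction_TM_correct; apply/allP => _ /mapP[u _ ->].
by rewrite size_map size_enum_ord sz.
Qed.

Local Open Scope ring_scope.

Theorem theorem3 (R : realType) :
  exists eps c : R, [/\ 0 < eps, 0 < c &
  exists f : vc_instance -> kmeans_instance,
  [/\ polytime_computable encode_vc encode_kmeans f,
      forall I : vc_instance, km_k (f I) = vc_k I &
      forall I : vc_instance,
        let G := vc_graph I in
        let k := (vc_k I)%:R : R in
        let m := #|edges G|%:R : R in
        ((exists S : {set 'I_(gorder G)}, vertex_cover S /\ #|S| = vc_k I) ->
         exists C : centers R (f I), kmeans_cost C <= Num.max 0 (m - k))
        /\
        ((forall S : {set 'I_(gorder G)},
            vertex_cover S -> k * (1 + eps) <= #|S|%:R) ->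
         m - (1 - c * eps) * k <= kmeans_opt R (f I))]].
Proof.
exists 1, (1 / 2); split; [by rewrite ltr01 | by rewrite divr_gt0 |].
exists reduction; split=> [|//|I G k m]; first exact: reduction_polytime.
have perm := perm_map (@indicator rat _) (perm_edge_list G).
split=> [[S [/covers_edges covS cS]]|vc].
  exact: (kmeans_cost_upper R (vc_k_gt0 I) (uniq_edge_points G) perm
            (@edges_card2 G) covS cS).
apply: lb_le_inf.
  by exists (@kmeans_cost R (reduction I) (fun=> 0)), (fun=> 0).
move=> _ [C _ <-].
have [|S /covers_edges/vc leS] := kmeans_cost_lower perm (@edges_card2 G) C.
  by move=> x y z; apply: edges_triangle_free; apply: vc_triangle_free.
by apply: le_trans; move: leS; rewrite -/k -/m; lra.
Qed.
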